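(* Let $E_1,E_2,E_3$ be real topological vector spaces, and let all tensor products be formed in the class of all real topological vector spaces. Let $\phi:E_1\otimes E_2\otimes E_3\to(E_1\otimes E_2)\otimes E_3$ be the continuous linear map (and isomorphism of vector spaces) determined by $\phi(x\otimes y\otimes z)=(x\otimes y)\otimes z$. Then: (a) If $E_3$ is locally bounded, then $\phi$ is an isomorphism of topological vector spaces. (b) If $E_1$ and $E_3$ are locally bounded, then the natural isomorphism of vector spaces $$\theta:(E_1\otimes E_2)\otimes E_3\to E_1\otimes(E_2\otimes E_3)$$ taking $(x\otimes y)\otimes z$ to $x\otimes(y\otimes z)$ is an isomorphism of topological vector spaces.
   Context: $\mathbb{N}=\{1,2,\ldots\}$. Topological vector spaces are not presumed Hausdorff or locally convex. A topological vector space is locally bounded if it has a bounded zero-neighbourhood. Given real topological vector spaces $E_1,\ldots,E_n$ ($n\ge 2$), a tensor product of $E_1,\ldots,E_n$ in the class of real topological vector spaces is a real topological vector space $T$ together with a continuous $n$-linear map $\tau:E_1\times\cdots\times E_n\to T$ such that for every real topological vector space $F$ and every continuous $n$-linear map $f:E_1\times\cdots\times E_n\to F$ there is a unique continuous linear map $\widetilde f:T\to F$ with $\widetilde f\circ\tau=f$. It is realized as follows, and is denoted $E_1\otimes\cdots\otimes E_n$: the underlying vector space is the algebraic tensor product $T=E_1\otimes_{\mathbb{R}}\cdots\otimes_{\mathbb{R}}E_n$ with $\tau(x_1,\ldots,x_n)=x_1\otimes\cdots\otimes x_n$, and a basis of zero-neighbourhoods for its vector topology is given by the sets $$\bigcup_{k\in\mathbb{N}}\sum_{\ell=1}^{k}\tau(U_{\ell,1}\times\cdots\times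 U_{\ell,n}),$$ where, for each $j=1,\ldots,n$, $(U_{k,j})_{k\in\mathbb{N}}$ is a sequence of balanced zero-neighbourhoods in $E_j$ (sums of sets are Minkowski sums). $E_1\otimes E_2\otimes E_3$ denotes the three-fold tensor product in this sense (for $n=3$), while $(E_1\otimes E_2)\otimes E_3$ and $E_1\otimes(E_2\otimes E_3)$ are iterated two-fold tensor products, where the inner tensor product carries its tensor product topology. *)

(* Defs.v *)
From HB Require Import structures.
From mathcomp Require Import all_boot all_order all_algebra.
From mathcomp Require Import boolp classical_sets filter reals topology normedtype.
(* The notations of monalg clash with those of MathComp-Analysis; only the
   free module malg K R (finitely supported functions K -> R) is used. *)
From mathcomp Require Import -(notations) monalg.

Set Implicit Arguments.
Unset Strict Implicit.
Unset Printing Implicit Defensive.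

Import Order.TTheory GRing.Theory Num.Theory.
Import numFieldNormedType.Exports.

Local Open Scope classical_set_scope.
Local Open Scope ring_scope.

(* MathComp-Analysis reserves the name tvsType for locally convex spaces; a
   general (possibly non-Hausdorff, non-locally-convex) real topological vector
   space is a topologicalLmodType R. *)

Section tvs_notions.
Context (R : realType).

Definition balanced (E : lmodType R) (U : set E) : Prop :=
  forall (a : R) (x : E), `|a| <= 1 -> U x -> U (a *: x).

Definition tvs_bounded (E : topologicalLmodType R) (B : set E) : Prop :=
  forall U : set E, nbhs 0 U ->
    exists s : R, 0 < s /\ forall t : R, s < t -> B `<=` *:%R t @` U.

Definition locally_bounded (E : topologicalLmodType R) : Prop :=
  exists B : set E, nbhs 0 B /\ tvs_bounded B.

Definition tvs_isomorphism (E F : topologicalLmodType R)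
    (f : {linear E -> F}) : Prop :=
  continuous f /\
  exists g : F -> E, [/\ cancel f g, cancel g f & continuous g].

End tvs_notions.

(* The algebraic tensor product of E_0, ..., E_(n-1): the free R-module on
   E_0 x ... x E_(n-1) modulo the submodule generated by the multilinearity
   relations. @dfwith _ _ x i w is the family x with its i-th entry replaced by w. *)
Section algebraic_tensor.
Context (R : realType) (n : nat) (E : 'I_n -> topologicalLmodType R).

Local Notation fam := (forall i, E i).
Local Notation free := (malg fam R).

Definition free_gen (x : fam) : free := mkmalgU x 1.

Definition tens_relator : set free :=
  [set g | exists (x : fam) (i : 'I_n) (a : R) (u v : E i),
     g = free_gen (dfwith x (a *: u + v))
         - (a *: free_gen (dfwith x u) + free_gen (dfwith x v))].

Definition tens_rel : {pred free} := fun g =>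
  `[< forall N : {pred free}, submod_closed N ->
        (forall r, tens_relator r -> r \in N) -> g \in N >].

Lemma tens_rel_submod : submod_closed tens_rel.
Proof.
split; first by apply/asboolP => N [N0 _] _.
move=> a u v /asboolP hu /asboolP hv; apply/asboolP => N NS NR.
by apply: (NS.2); [exact: hu|exact: hv].
Qed.

HB.instance Definition _ :=
  GRing.isSubmodClosed.Build R free tens_rel tens_rel_submod.

Definition tens : Type := Quotient.quot tens_rel.

HB.instance Definition _ := GRing.Zmodule.on tens.

Definition tens_pi : free -> tens := \pi_(Quotient.quot tens_rel)%qT.

Lemma tens_piD g h : tens_pi (g + h) = tens_pi g + tens_pi h.
Proof. exact: Quotient.pi_add. Qed.

Lemma tens_piN g : tens_pi (- g) = - tens_pi g.
Proof. exact: Quotient.pi_opp. Qed.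

Lemma tens_piK (t : tens) : tens_pi (repr t) = t.
Proof. exact: reprK. Qed.

Lemma tens_piP g h : reflect (tens_pi g = tens_pi h) (g - h \in tens_rel).
Proof. by rewrite Quotient.idealrBE; apply: eqP. Qed.

Definition tens_scale (a : R) (t : tens) : tens := tens_pi (a *: repr t).

Lemma tens_piZ a g : tens_pi (a *: g) = tens_scale a (tens_pi g).
Proof.
apply/tens_piP; rewrite -scalerBr; apply: rpredZ.
by apply/tens_piP; rewrite tens_piK.
Qed.

Lemma tens_scaleA a b t : tens_scale a (tens_scale b t) = tens_scale (a * b) t.
Proof. by rewrite -[t]tens_piK -!tens_piZ scalerA. Qed.

Lemma tens_scale1 : left_id 1 tens_scale.
Proof. by move=> t; rewrite -[t]tens_piK -!tens_piZ scale1r. Qed.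

Lemma tens_scaleDr : right_distributive tens_scale +%R.
Proof.
move=> a t u; rewrite -[t]tens_piK -[u]tens_piK -!(tens_piZ,tens_piD).
by rewrite scalerDr.
Qed.

Lemma tens_scaleDl t : {morph tens_scale^~ t : a b / a + b}.
Proof.
move=> a b; rewrite -[t]tens_piK -!(tens_piZ,tens_piD).
by rewrite scalerDl.
Qed.

HB.instance Definition _ := GRing.Zmodule_isLmodule.Build R tens
  tens_scaleA tens_scale1 tens_scaleDr tens_scaleDl.

Lemma tens_pi_linear : linear tens_pi.
Proof. by move=> a g h; rewrite tens_piD tens_piZ. Qed.

HB.instance Definition _ :=
  GRing.isLinear.Build R free tens *:%R tens_pi tens_pi_linear.

Definition tau (x : fam) : tens := tens_pi (free_gen x).

Lemma tau_linear (x : fam) i a (u v : E i) :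
  tau (dfwith x (a *: u + v)) = a *: tau (dfwith x u) + tau (dfwith x v).
Proof.
rewrite /tau -tens_pi_linear; apply/tens_piP/asboolP => N _ NR.
by apply: NR; exists x, i, a, u, v.
Qed.

Lemma tau_span (t : tens) :
  exists s : seq (R * fam), t = \sum_(p <- s) p.1 *: tau p.2.
Proof.
rewrite -[t]tens_piK [repr t]monalgE raddf_sum /=.
elim/big_rec : _ => [|x g _ [s ->]]; first by exists nil; rewrite big_nil.
exists ((mcoeff x (repr t), x) :: s); rewrite big_cons /=; congr (_ + _).
rewrite /tau -[RHS]linearZ; congr tens_pi.
by apply/malgP => k; rewrite mcoeffZ !mcoeffU mulrnAr mulr1.
Qed.

End algebraic_tensor.

(* tens_basic U is the union over k of the Minkowski sums, over l <= k, of
   tau (U l 0 x ... x U l (n+1)); these sets, for all sequences U of balanced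
   zero-neighbourhoods, form a basis at 0 of the topology. The empty tensor
   product has to be excluded: its basic sets are not absorbing. *)
Section tensor_topology.
Context (R : realType) (n : nat) (E : 'I_n.+2 -> topologicalLmodType R).

Local Notation fam := (forall i, E i).

Definition tau_sum (U : nat -> forall i, set (E i)) (k : nat) : set (tens E) :=
  [set t | exists x : nat -> fam,
     (forall l i, (l < k.+1)%N -> U l i (x l i)) /\
     t = \sum_(l < k.+1) tau (x l)].

Definition tens_basic (U : nat -> forall i, set (E i)) : set (tens E) :=
  \bigcup_k tau_sum U k.

Definition balanced_nbhs0 (U : nat -> forall i, set (E i)) : Prop :=
  forall l i, nbhs (0 : E i) (U l i) /\ balanced (U l i).

Definition tens_nbhs (t : tens E) : set_system (tens E) :=
  [set A | exists U, balanced_nbhs0 U /\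
     forall u, tens_basic U u -> A (t + u)].

Lemma dfwith_self (x : fam) i : dfwith x (x i) = x.
Proof.
apply: functional_extensionality_dep => j.
by case: (eqVneq i j) => [ij|ij]; [case: _ / ij; rewrite dfwith_in|rewrite dfwith_out].
Qed.

Lemma tau_dfwith0 (x : fam) i : tau (dfwith x (0 : E i)) = 0.
Proof.
have := tau_linear x 1 (0 : E i) 0.
by rewrite !scale1r addr0 => /eqP; rewrite -subr_eq subrr eq_sym => /eqP.
Qed.

Lemma tau_dfwithZ (x : fam) i a (u : E i) :
  tau (dfwith x (a *: u)) = a *: tau (dfwith x u).
Proof. by rewrite -[a *: u]addr0 tau_linear tau_dfwith0 addr0. Qed.

Lemma tau0 : tau (fun i => 0 : E i) = 0.
Proof. by rewrite -(dfwith_self (fun i => 0 : E i) ord0) tau_dfwith0. Qed.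

Lemma tau_scale (d : 'I_n.+2 -> R) (x : fam) :
  tau (fun i => d i *: x i) = (\prod_i d i) *: tau x.
Proof.
have H (s : seq 'I_n.+2) : uniq s ->
    tau (fun i => if i \in s then d i *: x i else x i) =
    (\prod_(i <- s) d i) *: tau x.
  elim: s => [_|i s IH /= /andP[iNs us]]; first by rewrite big_nil scale1r.
  pose y j := if j \in s then d j *: x j else x j.
  have yi : y i = x i by rewrite /y (negPf iNs).
  rewrite big_cons -scalerA -IH// -/y -[in RHS](dfwith_self y i).
  rewrite -tau_dfwithZ; congr tau; apply: functional_extensionality_dep => j.
  rewrite inE; case: (eqVneq i j) => [ij|ij].
    by case: _ / ij; rewrite dfwith_in /= yi.
  by rewrite dfwith_out.
have := H (index_enum 'I_n.+2) (index_enum_uniq _).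
move=> <-; congr tau; apply: functional_extensionality_dep => j.
by rewrite mem_index_enum.
Qed.

Lemma nbhs0_absorbing (F : topologicalLmodType R) (V : set F) (x : F) :
  nbhs 0 V -> exists2 e : R, 0 < e & V (e *: x).
Proof.
move=> V0; have /= := @scale_continuous R F (0, x) V.
rewrite scale0r => /(_ V0)[[A B] /= [A0 Bx] AB].
have /nbhs_ballP[e /= e0 eA] := A0.
exists (e / 2); first by rewrite divr_gt0.
apply: (AB (e / 2, x)); split => /=; last exact: nbhs_singleton.
apply: eA; rewrite /ball /= sub0r normrN gtr0_norm ?divr_gt0//.
by rewrite ltr_pdivrMr// ltr_pMr// ltr1n.
Qed.

Lemma balanced_nbhs0T : balanced_nbhs0 (fun l i => setT).
Proof. by move=> l i; split => //; exact: filterT. Qed.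

Lemma balanced_nbhs0I U V : balanced_nbhs0 U -> balanced_nbhs0 V ->
  balanced_nbhs0 (fun l i => U l i `&` V l i).
Proof.
move=> hU hV l i; have [U0 Ub] := hU l i; have [V0 Vb] := hV l i.
split; first exact: filterI.
by move=> a x a1 [Ux Vx]; split; [exact: Ub|exact: Vb].
Qed.

Lemma tens_basic_mono U V : (forall l i, U l i `<=` V l i) ->
  tens_basic U `<=` tens_basic V.
Proof.
move=> UV t [k _ [x [xU ->]]]; exists k => //; exists x; split => //.
by move=> l i lk; apply/UV/xU.
Qed.

Lemma tens_basic_pad U t : balanced_nbhs0 U -> tens_basic U t ->
  exists k, forall K, (k <= K)%N -> exists x : nat -> fam,
    (forall l i, U l i (x l i)) /\ t = \sum_(l < K) tau (x l).
Proof.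
move=> hU [k _ [x [xU ->]]]; exists k.+1 => K kK.
exists (fun l => if (l < k.+1)%N then x l else fun i => 0); split.
  move=> l i; case: ifPn => [/xU//|_].
  by have [U0 _] := hU l i; exact: nbhs_singleton.
rewrite (big_ord_widen K (fun l => tau (x l)))// big_mkcond /=.
by apply: eq_bigr => l _; case: ifPn => // _; rewrite tau0.
Qed.

Lemma tens_basic_sum U (x : nat -> fam) K : balanced_nbhs0 U ->
  (forall l i, U l i (x l i)) -> tens_basic U (\sum_(l < K) tau (x l)).
Proof.
move=> hU xU; exists K => //.
exists (fun l => if (l < K)%N then x l else fun i => 0); split.
  move=> l i _; case: ifPn => // _.
  by have [U0 _] := hU l i; exact: nbhs_singleton.
rewrite (big_ord_widen K.+1 (fun l => tau (x l)))// big_mkcond /=.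
by apply: eq_bigr => l _; case: ifPn => // _; rewrite tau0.
Qed.

Lemma tens_basic0 U : balanced_nbhs0 U -> tens_basic U 0.
Proof.
move=> hU; have := @tens_basic_sum U (fun l i => 0) 0 hU.
rewrite big_ord0; apply => l i.
by have [U0 _] := hU l i; exact: nbhs_singleton.
Qed.

Definition halve (U : nat -> forall i, set (E i)) l i :=
  U l.*2 i `&` U l.*2.+1 i.
Arguments halve : clear implicits.

Lemma balanced_nbhs0_halve U : balanced_nbhs0 U -> balanced_nbhs0 (halve U).
Proof.
move=> hU.
exact: (@balanced_nbhs0I (fun l => U l.*2) (fun l => U l.*2.+1)).
Qed.

Lemma halveP U t u : balanced_nbhs0 U ->
  tens_basic (halve U) t -> tens_basic (halve U) u -> tens_basic U (t + u).
Proof.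
move=> hU /(tens_basic_pad (balanced_nbhs0_halve hU))[k1 H1].
move=> /(tens_basic_pad (balanced_nbhs0_halve hU))[k2 H2].
have [x [xU ->]] := H1 _ (leq_maxl k1 k2).
have [y [yU ->]] := H2 _ (leq_maxr k1 k2).
set K := maxn _ _.
pose z l := if odd l then y l./2 else x l./2.
suff -> : \sum_(l < K) tau (x l) + \sum_(l < K) tau (y l) =
          \sum_(l < K.*2) tau (z l).
  apply: tens_basic_sum => // l i; rewrite /z -{1}(odd_double_half l).
  by case: (odd l); [have [] := yU l./2 i|have [] := xU l./2 i].
elim: K => [|K IH]; first by rewrite !big_ord0 addr0.
rewrite doubleS !big_ord_recr /= -IH /z /= odd_double /= doubleK.
by rewrite uphalf_double addrACA addrA.
Qed.

Lemma tens_basic_balanced U c t : balanced_nbhs0 U -> `|c| <= 1 ->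
  tens_basic U t -> tens_basic U (c *: t).
Proof.
move=> hU c1 [k _ [x [xU ->]]]; exists k => //.
exists (fun l => dfwith (x l) (c *: x l ord0)); split.
  move=> l i lk; have [i0|i0] := eqVneq ord0 i.
    by case: _ / i0; rewrite dfwith_in; apply: (hU _ _).2 => //; exact: xU.
  by rewrite dfwith_out//; exact: xU.
rewrite scaler_sumr; apply: eq_bigr => l _.
by rewrite tau_dfwithZ dfwith_self.
Qed.

Lemma tens_basic_absorbing U t : balanced_nbhs0 U ->
  exists2 e : R, 0 < e & forall c, `|c| <= e -> tens_basic U (c *: t).
Proof.
have [s ->] := tau_span t; move: U.
elim: s => [|[a x] s IH] U hU.
  exists 1 => // c _; rewrite big_nil scaler0; exact: tens_basic0.
have hU' := balanced_nbhs0_halve hU.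
have [e e0 He] := IH _ hU'.
have /choice[d dP] : forall i, exists d : R, 0 < d /\ halve U 0%N i (d *: x i).
  by move=> i; have [d d0 Ud] := nbhs0_absorbing (x i) (hU' 0%N i).1; exists d.
have P0 : 0 < \prod_i d i by apply: prodr_gt0 => i _; exact: (dP i).1.
pose e' := (\prod_i d i) / (`|a| + 1).
have a1 : 0 < `|a| + 1 by rewrite ltr_wpDl.
have e'0 : 0 < e' by rewrite divr_gt0.
exists (Num.min e e'); first by rewrite lt_min e0.
move=> c; rewrite le_min => /andP[ce ce']; rewrite big_cons scalerDr.
apply: halveP => //; last exact: He.
rewrite /= scalerA.
have -> : (c * a) *: tau x = (c * a / \prod_i d i) *: tau (fun i => d i *: x i).
  by rewrite tau_scale scalerA divfK// gt_eqF.
apply: tens_basic_balanced => //.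
  rewrite normrM normfV normrM (gtr0_norm P0) ler_pdivrMr// mul1r.
  rewrite (le_trans (ler_wpM2r _ ce'))// /e' mulrAC ler_pdivrMr//.
  by rewrite ler_wpM2l ?ltW// ltrDl.
exists 0%N => //; exists (fun _ i => d i *: x i); split.
  by case=> // i _; exact: (dP i).2.
by rewrite big_ord1.
Qed.

Lemma tens_basic_scale U m : balanced_nbhs0 U ->
  exists2 V, balanced_nbhs0 V &
    forall c t, `|c| <= 2 ^+ m -> tens_basic V t -> tens_basic U (c *: t).
Proof.
elim: m U => [|m IH] U hU.
  by exists U => // c t c1; exact: tens_basic_balanced.
have [V hV VU] := IH _ (balanced_nbhs0_halve hU); exists V => // c t cm Vt.
have -> : c *: t = (c / 2) *: t + (c / 2) *: t by rewrite -scalerDl -splitr.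
suff c2 : `|c / 2| <= 2 ^+ m by apply: halveP => //; exact: VU.
by rewrite normrM normfV (ger0_norm (ler0n _ 2)) ler_pdivrMr// -exprSr.
Qed.

Lemma tens_nbhs_filter t : ProperFilter (tens_nbhs t).
Proof.
split.
  move=> [U [hU /(_ 0)]]; apply; exact: tens_basic0.
split; first by exists (fun l i => setT); split=> //; exact: balanced_nbhs0T.
  move=> A B [U [hU UA]] [V [hV VB]].
  exists (fun l i => U l i `&` V l i); split; first exact: balanced_nbhs0I.
  move=> u uUV; split; [apply: UA|apply: VB]; apply: tens_basic_mono uUV.
    by move=> l i x [].
  by move=> l i x [].
by move=> A B AB [U [hU UA]]; exists U; split => // u /UA/AB.
Qed.

Lemma tens_nbhs_singleton (t : tens E) (A : set (tens E)) :
  tens_nbhs t A -> A t.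
Proof.
by move=> [U [hU UA]]; rewrite -[t]addr0; apply: UA; exact: tens_basic0.
Qed.

Lemma tens_nbhs_nbhs (t : tens E) (A : set (tens E)) :
  tens_nbhs t A -> tens_nbhs t (tens_nbhs^~ A).
Proof.
move=> [U [hU UA]]; exists (halve U); split; first exact: balanced_nbhs0_halve.
move=> u uU; exists (halve U); split; first exact: balanced_nbhs0_halve.
by move=> v vU; rewrite -addrA; apply: UA; exact: halveP.
Qed.

HB.instance Definition _ := hasNbhs.Build (tens E) tens_nbhs.
HB.instance Definition _ := Nbhs_isNbhsTopological.Build (tens E)
  tens_nbhs_filter tens_nbhs_singleton tens_nbhs_nbhs.

Lemma tens_add_continuous : continuous (fun x : tens E * tens E => x.1 + x.2).
Proof.
move=> [t u] A /= [U [hU UA]]; pose N x := +%R x @` tens_basic (halve U).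
have N_nbhs x : nbhs x (N x).
  exists (halve U); split; first exact: balanced_nbhs0_halve.
  by move=> v vU; exists v.
exists (N t, N u) => //= -[_ _] [/= [v vU <-] [w wU <-]].
by rewrite addrACA; apply: UA; exact: halveP.
Qed.

Lemma tens_scale_continuous : continuous (fun z : R^o * tens E => z.1 *: z.2).
Proof.
move=> [a t] A /= [U [hU UA]].
have hU' := balanced_nbhs0_halve hU.
have [e e0 He] := tens_basic_absorbing t hU'.
have [m am] : exists m, `|a| + 1 <= 2 ^+ m.
  exists (Num.bound (`|a| + 1)); apply: ltW.
  rewrite (lt_trans (archi_boundP _)) ?addr_ge0//.
  by rewrite -natrX ltr_nat ltn_expl.
have [V hV VU] := tens_basic_scale m hU'.
exists (ball a (Num.min e 1), +%R t @` tens_basic V) => /=.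
  split; first by apply: nbhsx_ballx; rewrite lt_min e0 ltr01.
  by exists V; split => // v vV; exists v.
move=> [b _] [/= ab [v vV <-]]; rewrite scalerDr.
have [abe ab1] : `|b - a| <= e /\ `|b - a| <= 1.
  move: ab; rewrite /ball /= distrC lt_min => /andP[/ltW ? /ltW ?].
  by split.
have -> : b *: t + b *: v = a *: t + ((b - a) *: t + b *: v).
  by rewrite addrA -scalerDl [a + _]addrC subrK.
apply: UA; apply: halveP => //; first exact: He.
apply: VU => //; apply: le_trans am.
by rewrite -[b](subrK a) addrC (le_trans (ler_normD _ _))// lerD2l.
Qed.

HB.instance Definition _ := PreTopologicalNmodule_isTopologicalNmodule.Build
  (tens E) tens_add_continuous.
HB.instance Definition _ := TopologicalNmodule_isTopologicalLmodule.Build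
  R (tens E) tens_scale_continuous.

End tensor_topology.

Section binary_ternary.
Context (R : realType).
Implicit Types E : topologicalLmodType R.

Definition fam2 E1 E2 (i : 'I_2) : topologicalLmodType R :=
  match val i with 0 => E1 | _ => E2 end.

Definition fam3 E1 E2 E3 (i : 'I_3) : topologicalLmodType R :=
  match val i with 0 => E1 | 1 => E2 | _ => E3 end.

Definition pair2 E1 E2 (x : E1) (y : E2) (i : 'I_2) : fam2 E1 E2 i :=
  match val i as k
    return (match k with 0 => E1 | _ => E2 end : topologicalLmodType R)
  with 0 => x | _ => y end.

Definition triple3 E1 E2 E3 (x : E1) (y : E2) (z : E3) (i : 'I_3) :
    fam3 E1 E2 E3 i :=
  match val i as k
    return (match k with 0 => E1 | 1 => E2 | _ => E3 end
            : topologicalLmodType R)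
  with 0 => x | 1 => y | _ => z end.

Definition tens2 E1 E2 : topologicalLmodType R := tens (fam2 E1 E2).

Definition tens3 E1 E2 E3 : topologicalLmodType R := tens (fam3 E1 E2 E3).

Definition tau2 E1 E2 (x : E1) (y : E2) : tens2 E1 E2 := tau (pair2 x y).

Definition tau3 E1 E2 E3 (x : E1) (y : E2) (z : E3) : tens3 E1 E2 E3 :=
  tau (triple3 x y z).

End binary_ternary.

(* Main.v *)
(* A linear map g out of a tensor product is continuous as soon as the
   multilinear map g \o tau is continuous at 0. For a trilinear f continuous
   at 0, the bilinear map (t, z) |-> f~(., ., z)(t) on (E1 (x) E2) x E3 is
   continuous at 0 when E3 has a bounded zero-neighbourhood B: if B is contained
   in r_l U_(l,3) for every l, then for z in B the factor r_l can be moved from z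
   to the first argument, so that one and the same z serves all the summands
   x_l (x) y_l of t once U_(l,1) is replaced by r_l^-1 U_(l,1). This gives the
   inverse of phi (f = tau3) and theta (f = x (x) (y (x) z)). Permuting the
   arguments cyclically gives the mirror statement, with E1 locally bounded, and
   hence the inverse of theta. *)
Require Import Defs.
From HB Require Import structures.
From mathcomp Require Import all_boot all_order all_algebra.
From mathcomp Require Import finmap.
From mathcomp Require Import boolp classical_sets filter reals topology normedtype.
From mathcomp Require Import -(notations) monalg.

Set Implicit Arguments.
Unset Strict Implicit.
Unset Printing Implicit Defensive.

Import Order.TTheory GRing.Theory Num.Theory.
Import numFieldNormedType.Exports.

Local Open Scope classical_set_scope.
Local Open Scope ring_scope.

(** * Universal property of the algebraic tensor product *)

Section universal_property.
Context (R : realType) (n : nat) (E : 'I_n -> topologicalLmodType R).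
Local Notation fam := (forall i, E i).

Lemma tens_ext (F : lmodType R) (g h : tens E -> F) :
  linear g -> linear h -> (forall x, g (tau x) = h (tau x)) -> g =1 h.
Proof.
move=> gl hl gh t; have [s ->] := tau_span t.
have f0 (f : tens E -> F) : linear f -> f 0 = 0.
  by move=> /scalable_linear/(_ 0 0) /=; rewrite !scale0r.
elim: s => [|p s IH]; first by rewrite big_nil !f0.
by rewrite big_cons gl hl gh IH.
Qed.

Section lift.
Context (F : lmodType R) (f : fam -> F).

Definition multilinear := forall (x : fam) i (a : R) (u v : E i),
  f (dfwith x (a *: u + v)) = a *: f (dfwith x u) + f (dfwith x v).

Let free_lift (g : malg fam R) : F := \sum_(k <- msupp g) mcoeff k g *: f k.

(** Enlarging the index set beyond the support allows the values at two elements to be compared over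
    the union of their supports. *)
Let free_liftEw (d : {fset fam}) g : fsubset (msupp g) d ->
  free_lift g = \sum_(k <- d) mcoeff k g *: f k.
Proof.
move=> gd; apply: big_fset_incl => // k _ kg.
by rewrite mcoeff_outdom// scale0r.
Qed.

Let free_lift_linear : linear free_lift.
Proof.
move=> a g h; pose d := fsetU (msupp g) (msupp h).
have gd : fsubset (msupp g) d by exact: fsubsetUl.
have hd : fsubset (msupp h) d by exact: fsubsetUr.
rewrite (free_liftEw gd) (free_liftEw hd) (@free_liftEw d).
  rewrite scaler_sumr -big_split; apply: eq_bigr => k _ /=.
  by rewrite mcoeffD mcoeffZ scalerA scalerDl.
apply: (fsubset_trans (msuppD_le _ _)).
by apply: fsetSU; exact: msuppZ_le.
Qed.

HB.instance Definition _ :=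
  GRing.isLinear.Build R (malg fam R) F *:%R free_lift free_lift_linear.

Let free_lift_gen x : free_lift (free_gen x) = f x.
Proof.
rewrite /free_lift /free_gen msuppU oner_eq0 big_seq_fset1.
by rewrite mcoeffUU scale1r.
Qed.

(** The linear extension of [f] to the free module kills the relators by multilinearity, hence all
    of [tens_rel], and so descends to the quotient. *)
Lemma tens_lift : multilinear ->
  exists g : {linear tens E -> F}, forall x, g (tau x) = f x.
Proof.
move=> fl.
have ker (g : malg fam R) : g \in @tens_rel R n E -> free_lift g = 0.
  (* The kernel is a submodule, so it can serve as [N] in the definition of [tens_rel]; only the
     relators remain to be checked. *)
  move=> /asboolP /(_ (fun g => free_lift g == 0)) H; apply/eqP/H.
    split=> [|a u v]; first by rewrite unfold_in linear0.
    rewrite !unfold_in free_lift_linear => /eqP -> /eqP ->.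
    by rewrite scaler0 addr0.
  move=> _ [x [i [a [u [v ->]]]]]; rewrite unfold_in.
  by rewrite linearB linearP /= !free_lift_gen fl subrr.
have repr_lift g : free_lift (repr (tens_pi (E := E) g)) = free_lift g.
  apply/eqP; rewrite -subr_eq0 -linearB; apply/eqP/ker/tens_piP.
  exact: tens_piK.
(* The descended map is evaluated on representatives; [repr_lift] makes the choice of representative
   immaterial. *)
pose G (t : tens E) := free_lift (repr t).
have Gl : linear G.
  move=> a t u; rewrite /G -[t in LHS]tens_piK -[u in LHS]tens_piK.
  by rewrite -linearP repr_lift linearP.
pose g := HB.pack_for {linear tens E -> F} G (GRing.isLinear.Build _ _ _ _ G Gl).
by exists g => x; rewrite /= /G repr_lift free_lift_gen.
Qed.

End lift.
End universal_property.

(** * Zero-neighbourhoods in topological vector spaces *)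

Section zero_neighbourhoods.
Context (R : realType) (F : topologicalLmodType R).

Lemma nbhs0_translate (W : set F) (t : F) : nbhs t W -> nbhs 0 (fun w => W (t + w)).
Proof.
move=> tW; have := @add_continuous F (t, 0) W.
rewrite /= addr0 => /(_ tW)[[A B] /= [At B0] AB].
by apply: filterS B0 => w Bw; apply: (AB (t, w)); split=> //; exact: nbhs_singleton.
Qed.

Lemma nbhs0_scale (W : set F) (r : R) : nbhs 0 W -> nbhs 0 (fun w => W (r *: w)).
Proof.
move=> W0; have := @scale_continuous R F (r, 0) W.
rewrite /= scaler0 => /(_ W0)[[A B] /= [Ar B0] AB].
by apply: filterS B0 => w Bw; apply: (AB (r, w)); split=> //; exact: nbhs_singleton.
Qed.

(** By joint continuity of scaling at the origin, c B lies in [W] for all |c| < e and some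
    zero-neighbourhood B; the union of these c B is balanced by construction. *)
Lemma nbhs0_balanced (W : set F) : nbhs 0 W ->
  exists V : set F, [/\ nbhs 0 V, balanced V & V `<=` W].
Proof.
move=> W0; have := @scale_continuous R F (0, 0) W.
rewrite /= scale0r => /(_ W0)[[A B] /= [/nbhs_ballP[e /= e0 eA] B0] AB].
exists [set c *: x | c in [set c : R | `|c| < e] & x in B]; split.
(* The union contains (e / 2) B, which is already a zero-neighbourhood. *)
- have e2 : 0 < e / 2 by rewrite divr_gt0.
  apply: filterS (nbhs0_scale (e / 2)^-1 B0) => x Bx.
  exists (e / 2); first by rewrite /= gtr0_norm// ltr_pdivrMr// ltr_pMr// ltr1n.
  by exists ((e / 2)^-1 *: x) => //; rewrite scalerA mulfV ?scale1r// gt_eqF.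
- move=> a _ a1 [c ce [x Bx <-]]; exists (a * c); last by exists x; rewrite ?scalerA.
  by rewrite /= normrM (le_lt_trans _ ce)// ler_piMl.
- move=> _ [c ce [x Bx <-]]; apply: (AB (c, x)); split=> //=.
  by apply: eA; rewrite /ball /= sub0r normrN.
Qed.

(** Repeated halving gives M_0 = W with M_(k+1) + M_(k+1) inside M_k, and N_l = M_(l+1). One
    sequence serves every number of summands, as the basic sets of the tensor topology require. *)
Lemma nbhs0_sums (W : set F) : nbhs 0 W ->
  exists N : nat -> set F, (forall k, nbhs 0 (N k)) /\
    forall k (w : nat -> F), (forall l, (l < k)%N -> N l (w l)) ->
      W (\sum_(l < k) w l).
Proof.
move=> W0.
(* Stated for every set A, with a dummy B when A is not a zero-neighbourhood, so that choice yields
   a total function that can be iterated. *)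
have half (A : set F) : exists B : set F, nbhs 0 A ->
    nbhs 0 B /\ forall x y, B x -> B y -> A (x + y).
  have [A0|] := pselect (nbhs 0 A); last by exists setT.
  have := @add_continuous F (0, 0) A.
  rewrite /= addr0 => /(_ A0)[[B C] /= [B0 C0] BC].
  exists (B `&` C) => _; split; first exact: filterI.
  by move=> x y [Bx _] [_ Cy]; exact: (BC (x, y)).
have /choice[h hP] := half.
pose M k := iter k h W.
have M0 k : nbhs 0 (M k) by elim: k => //= k /hP[].
exists (fun k => M k.+1); split=> // k w.
(* The starting index m is generalized for the induction: the first term and the sum of the others
   both lie in M_(m+1), hence their sum in M_m. *)
suff H m : (forall l, (l < k)%N -> M (m + l).+1 (w l)) -> M m (\sum_(l < k) w l).
  exact: (H 0%N).
elim: k w m => [|k IH] w m wM; first by rewrite big_ord0; exact: nbhs_singleton.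
rewrite big_ord_recl; apply: (hP _ (M0 m)).2.
  by have := wM 0%N; rewrite addn0; exact.
apply: (IH (fun l => w l.+1) m.+1) => l lk.
by rewrite addSnnS; exact: wM.
Qed.

End zero_neighbourhoods.

(** * Continuity of linear maps on a tensor product *)

Section continuity.
Context (R : realType) (n : nat) (E : 'I_n.+2 -> topologicalLmodType R).

(** Linearity of [g] moves the question to 0 and splits the image of a basic set into summands; it
    is enough to send the l-th summand into the l-th set given by [nbhs0_sums]. *)
Lemma tens_continuous (F : topologicalLmodType R) (g : {linear tens E -> F}) :
  (forall W, nbhs 0 W -> exists U : forall i, set (E i),
     (forall i, nbhs 0 (U i)) /\
     forall x, (forall i, U i (x i)) -> W (g (tau x))) ->
  continuous g.
Proof.
move=> gW t A /nbhs0_translate/nbhs0_sums[N [N0 NA]].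
have /choice[U UP] l : exists U : forall i, set (E i),
    (forall i, nbhs 0 (U i) /\ balanced (U i)) /\
    forall x, (forall i, U i (x i)) -> N l (g (tau x)).
  have [U [U0 UN]] := gW _ (N0 l).
  (* Basic sets are built from balanced neighbourhoods, so each [U i] is shrunk to a balanced
     one. *)
  have V i := cid (nbhs0_balanced (U0 i)).
  exists (fun i => projT1 (V i)); split=> [i|x xV].
    by case: (V i) => /= B [].
  apply: UN => i; move: (xV i); case: (V i) => /= B [_ _ BU]; exact: BU.
exists U; split=> [l i|_ [k _ [x [xU ->]]]]; first exact: (UP l).1.
rewrite /= linearD linear_sum.
apply: (NA _ (fun l => g (tau (x l)))) => l lk.
by apply: (UP l).2 => i; exact: xU.
Qed.

End continuity.

(** * Two-fold tensor products *)

Section binary.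
Context (R : realType).
Implicit Types E F : topologicalLmodType R.

Local Notation bilinear := (bilinear_for *:%R *:%R).

(** For bilinear [f] this is continuity at the origin, because f 0 0 = 0. *)
Definition bicontinuous0 E1 E2 F (f : E1 -> E2 -> F) :=
  forall W, nbhs 0 W -> exists U1 U2, [/\ nbhs 0 U1, nbhs 0 U2 &
    forall x y, U1 x -> U2 y -> W (f x y)].

Lemma ord2_ind (P : 'I_2 -> Prop) : P ord0 -> P ord_max -> forall i, P i.
Proof.
move=> P0 P1 [[|[|//]] i2]; first by rewrite (_ : Ordinal _ = ord0)//; apply/val_inj.
by rewrite (_ : Ordinal _ = ord_max)//; apply/val_inj.
Qed.

Lemma tau2E E1 E2 (x : forall i, fam2 E1 E2 i) :
  tau x = tau2 (x ord0 : E1) (x ord_max : E2).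
Proof.
by congr tau; apply: functional_extensionality_dep; apply: ord2_ind.
Qed.

Lemma tens2_ext E1 E2 (F : lmodType R) (g h : tens2 E1 E2 -> F) :
  linear g -> linear h ->
  (forall x y, g (tau2 x y) = h (tau2 x y)) -> g =1 h.
Proof. by move=> gl hl gh; apply: tens_ext => // x; rewrite tau2E. Qed.

Lemma multilinear2 E1 E2 (F : lmodType R) (f : E1 -> E2 -> F) : bilinear f ->
  multilinear (fun x : forall i, fam2 E1 E2 i => f (x ord0) (x ord_max)).
Proof.
move=> [fl fr] x; apply: ord2_ind => a u v.
  by rewrite !dfwith_in !dfwith_out//; exact: fl.
by rewrite !dfwith_in !dfwith_out//; exact: fr.
Qed.

Lemma tens2_lift E1 E2 (F : lmodType R) (f : E1 -> E2 -> F) : bilinear f ->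
  exists g : {linear tens2 E1 E2 -> F}, forall x y, g (tau2 x y) = f x y.
Proof.
by move=> /multilinear2/tens_lift[g gE]; exists g => x y; rewrite gE.
Qed.

Lemma tau2_bilinear E1 E2 : bilinear (@tau2 R E1 E2).
Proof.
split=> [y|x] a u v.
  have := @tau_linear R 2 (fam2 E1 E2) (pair2 0 y) ord0 a u v.
  by rewrite !tau2E !dfwith_in !dfwith_out.
have := @tau_linear R 2 (fam2 E1 E2) (pair2 x 0) ord_max a u v.
by rewrite !tau2E !dfwith_in !dfwith_out.
Qed.

Lemma tau2_bicontinuous0 E1 E2 : bicontinuous0 (@tau2 R E1 E2).
Proof.
move=> W [U [hU UW]]; exists (U 0%N ord0), (U 0%N ord_max).
split; [exact: (hU 0%N ord0).1|exact: (hU 0%N ord_max).1|move=> x y Ux Uy].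
(* Index k = 0 gives a single elementary tensor, since [tau_sum] runs over l < k.+1. *)
rewrite -[tau2 _ _]add0r; apply: UW; exists 0%N => //.
exists (fun _ => pair2 x y); rewrite big_ord1; split=> // l.
by case: l => // i _; apply: (@ord2_ind (fun i => U 0%N i (pair2 x y i))).
Qed.

Lemma tens2_continuous E1 E2 F (g : {linear tens2 E1 E2 -> F}) :
  bicontinuous0 (fun x y => g (tau2 x y)) -> continuous g.
Proof.
move=> gc; apply: tens_continuous => W /gc[U1 [U2 [U10 U20 UW]]].
pose U i : set (fam2 E1 E2 i) :=
  match val i as k
    return set (match k with 0 => E1 | _ => E2 end : topologicalLmodType R)
  with 0 => U1 | _ => U2 end.
exists U; split=> [|x xU]; first exact: ord2_ind.
by rewrite tau2E; apply: UW; [exact: (xU ord0)|exact: (xU ord_max)].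
Qed.

(** * Three-fold tensor products *)

Definition trilinear E1 E2 E3 (F : lmodType R) (f : E1 -> E2 -> E3 -> F) :=
  [/\ forall y z, linear (fun x => f x y z),
      forall x z, linear (fun y => f x y z) &
      forall x y, linear (f x y)].

Definition tricontinuous0 E1 E2 E3 F (f : E1 -> E2 -> E3 -> F) :=
  forall W, nbhs 0 W -> exists U1 U2 U3,
    [/\ nbhs 0 U1, nbhs 0 U2, nbhs 0 U3 &
    forall x y z, U1 x -> U2 y -> U3 z -> W (f x y z)].

Let ord3_1 : 'I_3 := @Ordinal 3 1 isT.

Lemma ord3_ind (P : 'I_3 -> Prop) :
  P ord0 -> P ord3_1 -> P ord_max -> forall i, P i.
Proof.
move=> P0 P1 P2 [[|[|[|//]]] i3].
- by rewrite (_ : Ordinal _ = ord0)//; apply/val_inj.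
- by rewrite (_ : Ordinal _ = ord3_1)//; apply/val_inj.
- by rewrite (_ : Ordinal _ = ord_max)//; apply/val_inj.
Qed.

Lemma tau3E E1 E2 E3 (x : forall i, fam3 E1 E2 E3 i) :
  tau x = tau3 (x ord0 : E1) (x ord3_1 : E2) (x ord_max : E3).
Proof.
by congr tau; apply: functional_extensionality_dep; apply: ord3_ind.
Qed.

Lemma tens3_ext E1 E2 E3 (F : lmodType R) (g h : tens3 E1 E2 E3 -> F) :
  linear g -> linear h ->
  (forall x y z, g (tau3 x y z) = h (tau3 x y z)) -> g =1 h.
Proof. by move=> gl hl gh; apply: tens_ext => // x; rewrite tau3E. Qed.

Lemma tens3_lift E1 E2 E3 (F : lmodType R) (f : E1 -> E2 -> E3 -> F) :
  trilinear f ->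
  exists g : {linear tens3 E1 E2 E3 -> F}, forall x y z, g (tau3 x y z) = f x y z.
Proof.
move=> [f1 f2 f3].
have [|g gE] := @tens_lift R 3 (fam3 E1 E2 E3) F
    (fun x => f (x ord0) (x ord3_1) (x ord_max)).
  by move=> x; apply: ord3_ind => a u v; rewrite !dfwith_in !dfwith_out//;
    [exact: f1|exact: f2|exact: f3].
by exists g => x y z; rewrite gE.
Qed.

Lemma tau3_trilinear E1 E2 E3 : trilinear (@tau3 R E1 E2 E3).
Proof.
split=> [y z|x z|x y] a u v.
- have := @tau_linear R 3 (fam3 E1 E2 E3) (triple3 0 y z) ord0 a u v.
  by rewrite !tau3E !dfwith_in !dfwith_out.
- have := @tau_linear R 3 (fam3 E1 E2 E3) (triple3 x 0 z) ord3_1 a u v.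
  by rewrite !tau3E !dfwith_in !dfwith_out.
- have := @tau_linear R 3 (fam3 E1 E2 E3) (triple3 x y 0) ord_max a u v.
  by rewrite !tau3E !dfwith_in !dfwith_out.
Qed.

Lemma tau3_tricontinuous0 E1 E2 E3 : tricontinuous0 (@tau3 R E1 E2 E3).
Proof.
move=> W [U [hU UW]].
exists (U 0%N ord0), (U 0%N ord3_1), (U 0%N ord_max); split.
- exact: (hU 0%N ord0).1.
- exact: (hU 0%N ord3_1).1.
- exact: (hU 0%N ord_max).1.
move=> x y z Ux Uy Uz; rewrite -[tau3 _ _ _]add0r; apply: UW; exists 0%N => //.
exists (fun _ => triple3 x y z); rewrite big_ord1; split=> // l.
by case: l => // i _; apply: (@ord3_ind (fun i => U 0%N i (triple3 x y z i))).
Qed.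

Lemma tens3_continuous E1 E2 E3 F (g : {linear tens3 E1 E2 E3 -> F}) :
  tricontinuous0 (fun x y z => g (tau3 x y z)) -> continuous g.
Proof.
move=> gc; apply: tens_continuous => W /gc[U1 [U2 [U3 [U10 U20 U30 UW]]]].
pose U i : set (fam3 E1 E2 E3 i) :=
  match val i as k
    return set (match k with 0 => E1 | 1 => E2 | _ => E3 end
                : topologicalLmodType R)
  with 0 => U1 | 1 => U2 | _ => U3 end.
exists U; split=> [|x xU]; first exact: ord3_ind.
rewrite tau3E.
by apply: UW; [exact: (xU ord0)|exact: (xU ord3_1)|exact: (xU ord_max)].
Qed.

(** * Iterated two-fold tensor products *)

Lemma tens2l_ext E1 E2 E3 (F : lmodType R) (g h : tens2 (tens2 E1 E2) E3 -> F) :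
  linear g -> linear h ->
  (forall x y z, g (tau2 (tau2 x y) z) = h (tau2 (tau2 x y) z)) -> g =1 h.
Proof.
move=> gl hl gh; apply: tens2_ext => // t z; move: t.
have taul := (tau2_bilinear (tens2 E1 E2) E3).1 z.
by apply: tens2_ext => [a u v|a u v|//]; rewrite taul ?gl ?hl.
Qed.

Lemma tens2r_ext E1 E2 E3 (F : lmodType R) (g h : tens2 E1 (tens2 E2 E3) -> F) :
  linear g -> linear h ->
  (forall x y z, g (tau2 x (tau2 y z)) = h (tau2 x (tau2 y z))) -> g =1 h.
Proof.
move=> gl hl gh; apply: tens2_ext => // x.
have taur := (tau2_bilinear E1 (tens2 E2 E3)).2 x.
by apply: tens2_ext => [a u v|a u v|//]; rewrite taur ?gl ?hl.
Qed.

(** For fixed z, the map t |-> L t z is the lift of f (., ., z), linear by construction. Linearity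
    in z passes from elementary tensors to all t, both sides of the identity being linear in t. *)
Lemma tens2_curry E1 E2 E3 F (f : E1 -> E2 -> E3 -> F) : trilinear f ->
  exists L : tens2 E1 E2 -> E3 -> F,
    [/\ bilinear L, forall x y z, L (tau2 x y) z = f x y z &
        locally_bounded E3 -> tricontinuous0 f -> bicontinuous0 L].
Proof.
move=> [f1 f2 f3].
have /choice[L Lf] z : exists g : {linear tens2 E1 E2 -> F},
    forall x y, g (tau2 x y) = f x y z.
  by apply: (@tens2_lift _ _ _ (fun x y => f x y z)); split.
exists (fun t z => L z t); split=> [|x y z|]; last 2 first.
- exact: Lf.
- move=> [B [B0 Bb]] fc W /nbhs0_sums[N [N0 NW]].
  (* The neighbourhoods U depend on l, whereas the bounded set B is the same for every l. *)
  have scaled l : exists U : forall i, set (fam2 E1 E2 i),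
      (forall i, nbhs 0 (U i) /\ balanced (U i)) /\
      forall x y z, U ord0 x -> U ord_max y -> B z -> N l (f x y z).
    have [U1 [U2 [U3 [U10 U20 U30 UN]]]] := fc _ (N0 l).
    have [s [s0 Bs]] := Bb _ U30.
    (* Boundedness puts B inside t U3 for all t > s, and s + 1 is one such t. Below, V1 is chosen
       inside the set of x with r x in U1. *)
    pose r := s + 1; have r0 : r != 0 by rewrite gt_eqF// ltr_wpDl// ltW.
    have [V1 [V10 V1b V1U]] := nbhs0_balanced (nbhs0_scale r U10).
    have [V2 [V20 V2b V2U]] := nbhs0_balanced U20.
    pose V i : set (fam2 E1 E2 i) :=
      match val i as k
        return set (match k with 0 => E1 | _ => E2 end : topologicalLmodType R)
      with 0 => V1 | _ => V2 end.
    exists V; split=> [|x y z Vx Vy]; first exact: ord2_ind.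
    move=> /(Bs r _)[|z' Uz' <-]; first by rewrite ltrDl.
    have -> : f x y (r *: z') = f (r *: x) y z'.
      by rewrite (scalable_linear (f3 x y)) (scalable_linear (f1 y z')).
    by apply: UN => //; [exact: V1U|exact: V2U].
  have /choice[U UP] := scaled.
  have U0 : balanced_nbhs0 U by move=> l i; exact: (UP l).1.
  exists (tens_basic U), B; split=> //.
    by exists U; split=> // u Uu; rewrite add0r.
  move=> _ z [k _ [x [xU ->]]] Bz; rewrite linear_sum.
  apply: (NW _ (fun l => L z (tau (x l)))) => l lk.
  by rewrite tau2E Lf; apply: (UP l).2 => //; exact: xU.
split=> [z|t]; first exact: linearP.
move=> a u v; move: t; apply: tens2_ext => [|b t t'|x y].
- exact: linearP.
(* The combination of lifts on the right-hand side is again linear in t, by commutativity of the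
   scalars. *)
- have Ll z := linearP (L z).
  by rewrite /= !Ll !scalerDr !scalerA [b * a]mulrC addrACA.
- by rewrite !Lf f3.
Qed.

Lemma tens2_liftl E1 E2 E3 F (f : E1 -> E2 -> E3 -> F) : trilinear f ->
  exists g : {linear tens2 (tens2 E1 E2) E3 -> F},
    (forall x y z, g (tau2 (tau2 x y) z) = f x y z) /\
    (locally_bounded E3 -> tricontinuous0 f -> continuous g).
Proof.
move=> /tens2_curry[L [Lb Lf Lc]]; have [g gL] := tens2_lift Lb; exists g.
split=> [x y z|E3b fc]; first by rewrite gL Lf.
apply: tens2_continuous => W W0; have [U1 [U2 [U10 U20 UW]]] := Lc E3b fc W W0.
by exists U1, U2; split=> // t z Ut Uz; rewrite gL; exact: UW.
Qed.

Lemma tens2_liftr E1 E2 E3 F (f : E1 -> E2 -> E3 -> F) : trilinear f ->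
  exists g : {linear tens2 E1 (tens2 E2 E3) -> F},
    (forall x y z, g (tau2 x (tau2 y z)) = f x y z) /\
    (locally_bounded E1 -> tricontinuous0 f -> continuous g).
Proof.
move=> [f1 f2 f3].
(* Rotated to (y, z, x), the arguments have E1 in the third place, where [tens2_curry] asks for
   local boundedness. *)
have [|L [[Ll Lr] Lf Lc]] := @tens2_curry E2 E3 E1 F (fun y z x => f x y z).
  by split.
have [|g gL] := @tens2_lift _ _ _ (fun x t => L t x); first by split.
exists g; split=> [x y z|E1b fc]; first by rewrite gL Lf.
apply: tens2_continuous => W W0; have [|U1 [U2 [U10 U20 UW]]] := Lc E1b _ W W0.
  move=> W' /fc[V1 [V2 [V3 [V10 V20 V30 VW]]]].
  by exists V2, V3, V1; split=> // y z x Vy Vz Vx; exact: VW.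
by exists U2, U1; split=> // x t Ux Ut; rewrite gL; exact: UW.
Qed.

Lemma tau2l_trilinear E1 E2 E3 :
  trilinear (fun (x : E1) (y : E2) (z : E3) => tau2 (tau2 x y) z).
Proof.
have [tl tr] := tau2_bilinear E1 E2.
have [tl' tr'] := tau2_bilinear (tens2 E1 E2) E3.
split=> [y z|x z|x y] a u v; last exact: tr'.
  by rewrite tl tl'.
by rewrite tr tl'.
Qed.

Lemma tau2r_trilinear E1 E2 E3 :
  trilinear (fun (x : E1) (y : E2) (z : E3) => tau2 x (tau2 y z)).
Proof.
have [tl tr] := tau2_bilinear E2 E3.
have [tl' tr'] := tau2_bilinear E1 (tens2 E2 E3).
split=> [y z|x z|x y] a u v; first exact: tl'.
  by rewrite tl tr'.
by rewrite tr tr'.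
Qed.

(** The outer [tau2] yields a zero-neighbourhood V of the inner tensor product, to which
    bicontinuity of the inner [tau2] applies. *)
Lemma tau2l_tricontinuous0 E1 E2 E3 :
  tricontinuous0 (fun (x : E1) (y : E2) (z : E3) => tau2 (tau2 x y) z).
Proof.
move=> W /tau2_bicontinuous0[V [U3 [V0 U30 VW]]].
have [U1 [U2 [U10 U20 UV]]] := tau2_bicontinuous0 V0.
by exists U1, U2, U3; split=> // x y z Ux Uy Uz; apply: VW => //; exact: UV.
Qed.

Lemma tau2r_tricontinuous0 E1 E2 E3 :
  tricontinuous0 (fun (x : E1) (y : E2) (z : E3) => tau2 x (tau2 y z)).
Proof.
move=> W /tau2_bicontinuous0[U1 [V [U10 V0 VW]]].
have [U2 [U3 [U20 U30 UV]]] := tau2_bicontinuous0 V0.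
by exists U1, U2, U3; split=> // x y z Ux Uy Uz; apply: VW => //; exact: UV.
Qed.

End binary.

(** * The isomorphisms [phi] and [theta] *)

Theorem proposition2 (R : realType) (E1 E2 E3 : topologicalLmodType R) :
  (exists phi : {linear tens3 E1 E2 E3 -> tens2 (tens2 E1 E2) E3},
    [/\ forall x y z, phi (tau3 x y z) = tau2 (tau2 x y) z,
        forall phi' : {linear tens3 E1 E2 E3 -> tens2 (tens2 E1 E2) E3},
          (forall x y z, phi' (tau3 x y z) = tau2 (tau2 x y) z) ->
          phi' =1 phi,
        continuous phi,
        bijective phi &
        locally_bounded E3 -> tvs_isomorphism phi]) /\
  (exists theta : {linear tens2 (tens2 E1 E2) E3 -> tens2 E1 (tens2 E2 E3)},
    [/\ forall x y z, theta (tau2 (tau2 x y) z) = tau2 x (tau2 y z),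
        forall theta' : {linear tens2 (tens2 E1 E2) E3 ->
                                tens2 E1 (tens2 E2 E3)},
          (forall x y z, theta' (tau2 (tau2 x y) z) = tau2 x (tau2 y z)) ->
          theta' =1 theta,
        bijective theta &
        locally_bounded E1 -> locally_bounded E3 -> tvs_isomorphism theta]).
Proof.
(* The maps [psi] and [eta] are the candidate inverses of [phi] and [theta]. *)
have [phi phiE] := tens3_lift (tau2l_trilinear E1 E2 E3).
have [psi [psiE psic]] := tens2_liftl (tau3_trilinear E1 E2 E3).
have [theta [thetaE thetac]] := tens2_liftl (tau2r_trilinear E1 E2 E3).
have [eta [etaE etac]] := tens2_liftr (tau2l_trilinear E1 E2 E3).
have phic : continuous phi.
  apply: tens3_continuous => W /tau2l_tricontinuous0[U1 [U2 [U3 [? ? ? UW]]]].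
  by exists U1, U2, U3; split=> // x y z ? ? ?; rewrite phiE; exact: UW.
(* Each of the four cancellations compares a linear composite with the identity on elementary
   tensors. *)
have phiK : cancel phi psi.
  apply: (@tens3_ext _ _ _ _ _ (psi \o phi) id) => [a u v|//|x y z].
    by rewrite /= !linearP.
  by rewrite /= phiE psiE.
have psiK : cancel psi phi.
  apply: (@tens2l_ext _ _ _ _ _ (phi \o psi) id) => [a u v|//|x y z].
    by rewrite /= !linearP.
  by rewrite /= psiE phiE.
have thetaK : cancel theta eta.
  apply: (@tens2l_ext _ _ _ _ _ (eta \o theta) id) => [a u v|//|x y z].
    by rewrite /= !linearP.
  by rewrite /= thetaE etaE.
have etaK : cancel eta theta.
  apply: (@tens2r_ext _ _ _ _ _ (theta \o eta) id) => [a u v|//|x y z].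
    by rewrite /= !linearP.
  by rewrite /= etaE thetaE.
split.
  exists phi; split=> //.
  - move=> phi' phi'E; apply: tens3_ext => [||x y z]; [exact: linearP..|].
    by rewrite phi'E phiE.
  - by exists psi.
  - move=> E3b; split=> //; exists psi; split=> //.
    by apply: psic => //; exact: tau3_tricontinuous0.
exists theta; split=> //.
- move=> theta' theta'E; apply: tens2l_ext => [||x y z]; [exact: linearP..|].
  by rewrite theta'E thetaE.
- by exists eta.
(* Local boundedness of E3 makes [theta] continuous, that of E1 makes [eta] continuous. *)
- move=> E1b E3b; split; first by apply: thetac => //; exact: tau2r_tricontinuous0.
  exists eta; split=> //.
  by apply: etac => //; exact: tau2l_tricontinuous0.
Qed.
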